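(* Let $X\subset\mathbb{R}^n$ be a convex closed set. Assume that $f\in\mathbb{R}[x]$, $x=(x_1,\dots,x_n)$, is a polynomial of degree $d>0$ which is positive on $X$, that its leading form $f_d$ satisfies $f_d^{-1}(0)=\{0\}$, and that there exists $m>0$ such that $\inf\{f(x):x\in X\}\ge m$. Then there exists $N_0\in\mathbb{N}$ such that for any integer $N\ge N_0$ and any $\xi\in\mathbb{R}^n$ the function $\varphi_{N,\xi}(x)=e^{N|x-\xi|^2}f(x)$ is strongly convex on $X$.
   Context: $|\cdot|$ is the Euclidean norm on $\mathbb{R}^n$. The leading form $f_d$ of a polynomial $f$ of degree $d$ is its homogeneous component of degree $d$. A function $\varphi$ is strongly convex on a convex set $X$ if for some $\mu>0$ the function $\varphi(x)-\frac{\mu}{2}|x|^2$ is convex on $X$. *)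

(* Defs.v *)
From HB Require Import structures.
From mathcomp Require Import all_boot all_order all_algebra.
From mathcomp Require Import all_classical all_reals all_analysis.
(* A full import of [mpoly] would clash with the notations of analysis. *)
From mathcomp Require Import (canonicals, coercions) mpoly.

Set Implicit Arguments.
Unset Strict Implicit.
Unset Printing Implicit Defensive.

Import Order.TTheory GRing.Theory Num.Theory.
Import numFieldNormedType.Exports.

Local Open Scope classical_set_scope.
Local Open Scope ring_scope.

(* The canonical norm [`|x|] on ['rV[R]_n] is the sup norm; [closed] does not
   depend on this choice, but the norm in the exponential does. *)
Definition enorm (R : realType) (n : nat) (x : 'rV[R]_n) : R :=
  Num.sqrt (\sum_(i < n) x ord0 i ^+ 2).

Definition peval (R : realType) (n : nat) (f : mpoly.mpoly n R)
    (x : 'rV[R]_n) : R :=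
  mpoly.meval (fun i => x ord0 i) f.

(* [msize] is one more than the total degree, and [msize 0 = 0]; hence the zero
   polynomial has no degree. *)
Definition has_degree (R : realType) (n : nat) (f : mpoly.mpoly n R)
    (d : nat) : Prop :=
  mpoly.msize f = d.+1.

Definition hom_component (R : realType) (n : nat) (d : nat)
    (f : mpoly.mpoly n R) : mpoly.mpoly n R :=
  mpoly.pihomog mpoly.mdeg d f.

Definition strongly_convex (R : realType) (n : nat) (X : set 'rV[R]_n)
    (phi : 'rV[R]_n -> R) : Prop :=
  exists2 mu : R, 0 < mu &
    convex_function X (fun x => phi x - mu / 2 * enorm x ^+ 2).

(* Main.v *)
Require Import Defs.
From HB Require Import structures.
From mathcomp Require Import all_boot all_order all_algebra.
From mathcomp Require Import all_classical all_reals all_analysis.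
From mathcomp Require Import (canonicals, coercions) mpoly.
From mathcomp Require Import ring lra.

Set Implicit Arguments.
Unset Strict Implicit.
Unset Printing Implicit Defensive.

Import Order.TTheory GRing.Theory Num.Theory.
Import numFieldNormedType.Exports.

Local Open Scope classical_set_scope.
Local Open Scope ring_scope.

(** Strong convexity is tested on segments, so fix a point x of X and a unit
    direction u, and put P(t) = f(x + t u) and Q(t) = N |x - xi + t u|^2, which
    are univariate polynomials with Q'' = 2 N.  Then
<<
      (exp(Q) P)'' = exp(Q) ((2 N + Q'^2) P + 2 Q' P' + P'').
>>
    Suppose that |P'| <= C P and |P''| <= C P on X, with C independent of x and
    u.  The quadratic Q'^2 P + 2 Q' P' in the uncontrolled quantity Q' is at
    least - C^2 P, so that the bracket is at least (2 N - C^2 - C) P, hence at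
    least P >= m once 2 N >= C^2 + C + 1.  As exp(Q) >= 1, the second
    derivative is at least m, uniformly in xi, and m serves as the modulus of
    strong convexity ([second_order_bound], [strongly_convex_exp_sqdist]).

    The constant C comes from comparing both sides with (1 + |x|)^d, where from
    here on |x| is the sup norm, for which monomials are bounded directly.  The
    derivatives of P at t are read off the coefficients of degree 1 and 2 of
    the polynomial attached to the point x + t u; these are dominated
    coefficientwise by those of a sum of multiples of powers (|x| + T)^k with
    k <= d, hence are O((1 + |x|)^d) ([restr_poly_coef_bound]).  Conversely
    (1 + |x|)^d = O(f(x)) on X ([growth_bound]): since f_d has no zero on the
    compact unit sphere, |f_d(x)| >= c |x|^d, which beats the lower-degree
    terms for large x, while for bounded x the inequality f >= m suffices. *)

(** * Restriction of a polynomial to a line *)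

Definition line_poly (R : realType) n (x u : 'rV[R]_n) (i : 'I_n) : {poly R} :=
  (x ord0 i)%:P + u ord0 i *: 'X.

Definition restr_poly (R : realType) n (f : mpoly.mpoly n R) (x u : 'rV[R]_n) :
    {poly R} :=
  mpoly.mmap (@polyC R) (line_poly x u) f.

Definition sqdist_poly (R : realType) n (x u : 'rV[R]_n) : {poly R} :=
  \sum_i line_poly x u i ^+ 2.

(** Coefficientwise majorants bound all Taylor coefficients of [restr_poly] at
    once, without any multivariate differentiation. *)
Definition dominated (R : realType) (p q : {poly R}) :=
  forall k, `|p`_k| <= q`_k.

Section lines.
Variables (R : realType) (n : nat).
Implicit Types (f : mpoly.mpoly n R) (x u : 'rV[R]_n) (t : R).

Lemma horner_line_poly x u t i : (line_poly x u i).[t] = (x + t *: u) ord0 i.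
Proof. by rewrite !hornerE !mxE mulrC. Qed.

Lemma horner_restr_poly f x u t : (restr_poly f x u).[t] = peval f (x + t *: u).
Proof.
rewrite /peval mpoly.mevalE /restr_poly /mpoly.mmap horner_sum.
apply: eq_bigr => m _; rewrite hornerM hornerC /mpoly.mmap1 horner_prod.
by congr (_ * _); apply: eq_bigr => i _; rewrite horner_exp horner_line_poly.
Qed.

Lemma line_poly_shift x u t i :
  line_poly x u i \Po ('X + t%:P) = line_poly (x + t *: u) u i.
Proof.
rewrite /line_poly comp_polyD comp_polyC comp_polyZ comp_polyX !mxE.
by rewrite scalerDr polyCD polyCM -!mul_polyC; ring.
Qed.

(** Moving the base point along the line is a translation of the variable, so
    a bound on coefficients that holds at every base point is a bound on
    derivatives along the whole line. *)
Lemma restr_poly_shift f x u t :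
  restr_poly f x u \Po ('X + t%:P) = restr_poly f (x + t *: u) u.
Proof.
rewrite /restr_poly /mpoly.mmap rmorph_sum/=; apply: eq_bigr => m _.
rewrite comp_polyM comp_polyC; congr (_ * _).
rewrite /mpoly.mmap1 rmorph_prod/=; apply: eq_bigr => i _.
by rewrite rmorphXn/= line_poly_shift.
Qed.

Lemma deriv_horner_shift (p : {poly R}) t :
  p^`().[t] = (p \Po ('X + t%:P))`_1.
Proof.
have -> (q : {poly R}) : q`_1 = q^`().[0] by rewrite horner_coef0 coef_deriv mulr1n.
rewrite deriv_comp derivD derivX derivC addr0 mulr1.
by rewrite horner_comp !hornerE.
Qed.

Lemma deriv2_horner_shift (p : {poly R}) t :
  p^`()^`().[t] = (p \Po ('X + t%:P))`_2 *+ 2.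
Proof.
rewrite deriv_horner_shift.
have -> : p^`() \Po ('X + t%:P) = (p \Po ('X + t%:P))^`().
  by rewrite deriv_comp derivD derivX derivC addr0 mulr1.
by rewrite coef_deriv.
Qed.

(** * Euclidean and sup norms *)

Lemma enorm_ge0 x : 0 <= enorm x. Proof. exact: sqrtr_ge0. Qed.

Lemma sqr_enorm x : enorm x ^+ 2 = \sum_i x ord0 i ^+ 2.
Proof. by rewrite sqr_sqrtr// sumr_ge0// => i _; exact: sqr_ge0. Qed.

Lemma enormZ t x : enorm (t *: x) = `|t| * enorm x.
Proof.
rewrite -sqrtr_sqr -sqrtrM ?sqr_ge0// mulr_sumr; congr Num.sqrt.
by apply: eq_bigr => i _; rewrite mxE exprMn.
Qed.

Lemma coord_le_enorm x i : `|x ord0 i| <= enorm x.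
Proof.
rewrite -sqrtr_sqr ler_wsqrtr// (bigD1 i)//= lerDl sumr_ge0// => j _.
exact: sqr_ge0.
Qed.

Lemma enorm_eq0 x : enorm x = 0 -> x = 0.
Proof.
move=> x0; apply/rowP => i; apply/eqP; rewrite mxE -normr_le0 -x0.
exact: coord_le_enorm.
Qed.

Lemma horner_sqdist_poly x u t : (sqdist_poly x u).[t] = enorm (x + t *: u) ^+ 2.
Proof.
rewrite sqr_enorm horner_sum; apply: eq_bigr => i _.
by rewrite horner_exp horner_line_poly.
Qed.

Lemma deriv2_sqdist_poly x u :
  (sqdist_poly x u)^`()^`() = (2 * enorm u ^+ 2)%:P.
Proof.
rewrite sqr_enorm /sqdist_poly 2!raddf_sum mulr_sumr rmorph_sum.
apply: eq_bigr => i _.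
have dline : (line_poly x u i)^`() = (u ord0 i)%:P.
  by rewrite derivD derivC derivZ derivX alg_polyC add0r.
rewrite /= expr2 derivM dline derivD !derivM dline derivC.
by rewrite expr2 !polyCM polyC_natr; ring.
Qed.

Lemma coord_le_norm x i : `|x ord0 i| <= `|x|.
Proof.
rewrite [leRHS]/Num.norm /= mx_normrE.
by apply/bigmax_geP; right => /=; exists (ord0, i).
Qed.

(** * Coefficient bounds by majorants *)

Lemma dominatedM (p1 p2 q1 q2 : {poly R}) :
  dominated p1 q1 -> dominated p2 q2 -> dominated (p1 * p2) (q1 * q2).
Proof.
move=> d1 d2 k; rewrite !coefM; apply: le_trans (ler_norm_sum _ _ _) _.
by apply: ler_sum => i _; rewrite normrM ler_pM.
Qed.

Lemma dominated_polyC (a : R) : dominated a%:P `|a|%:P.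
Proof. by move=> k; rewrite !coefC; case: eqP => _; rewrite ?normr0. Qed.

Lemma dominated1 : dominated (1 : {poly R}) 1.
Proof. by move=> k; rewrite !coef1; case: eqP => _; rewrite ?normr0 ?normr1. Qed.

Lemma dominatedX (p q : {poly R}) k : dominated p q -> dominated (p ^+ k) (q ^+ k).
Proof.
move=> d; elim: k => [|k ih]; first exact: dominated1.
by rewrite !exprS; exact: dominatedM.
Qed.

(** A majorant has nonnegative coefficients, and its value at 1 is their sum. *)
Lemma dominated_horner1 (p q : {poly R}) k : dominated p q -> `|p`_k| <= q.[1].
Proof.
move=> d; apply: le_trans (d k) _.
have q0 i : 0 <= q`_i by exact: le_trans (d i).
rewrite horner_coef; under eq_bigr do rewrite expr1n mulr1.
have [kq|kq] := ltnP k (size q); last by rewrite nth_default// sumr_ge0.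
by rewrite (bigD1 (Ordinal kq))//= lerDl sumr_ge0.
Qed.

Lemma dominated_line_poly x u i : enorm u <= 1 ->
  dominated (line_poly x u i) (`|x|%:P + 'X).
Proof.
move=> u1 k; rewrite !coefD coefZ !coefC !coefX.
case: k => [|[|k]]/=; rewrite ?mulr0 ?addr0 ?add0r ?mulr1 ?normr0//.
  exact: coord_le_norm.
by apply: le_trans u1; exact: coord_le_enorm.
Qed.

(** Each monomial of degree k is majorized by [(`|x|%:P + 'X) ^+ k], whose value
    at 1 is at most [(1 + `|x|) ^+ e].  The constant is the sum of the absolute
    values of the coefficients of [f]. *)
Lemma restr_poly_coef_bound f e : (mpoly.msize f <= e.+1)%N ->
  exists2 A : R, 0 <= A & forall x u k, enorm u <= 1 ->
    `|(restr_poly f x u)`_k| <= A * (1 + `|x|) ^+ e.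
Proof.
move=> sf; exists (\sum_(m <- mpoly.msupp f) `|mpoly.mcoeff m f|).
  by rewrite sumr_ge0.
move=> x u k u1; rewrite mulr_suml /restr_poly /mpoly.mmap coef_sum.
apply: le_trans (ler_norm_sum _ _ _) _; rewrite big_seq [leRHS]big_seq.
apply: ler_sum => m mf.
have dm : dominated (polyC (mpoly.mcoeff m f) * mpoly.mmap1 (line_poly x u) m)
    ((`|mpoly.mcoeff m f|)%:P * (`|x|%:P + 'X) ^+ mpoly.mdeg m).
  apply: dominatedM; first exact: dominated_polyC.
  rewrite mpoly.mdegE -prodrXr /mpoly.mmap1.
  elim/big_ind2 : _ => [|? ? ? ?|i _]; first exact: dominated1.
    exact: dominatedM.
  exact/dominatedX/dominated_line_poly.
apply: le_trans (dominated_horner1 k dm) _.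
rewrite hornerM hornerC horner_exp !hornerE ler_wpM2l// [`|x| + 1]addrC ler_weXn2l//.
  by rewrite lerDl.
by have := leq_trans (mpoly.msize_mdeg_lt mf) sf; rewrite ltnS.
Qed.

Lemma peval_bound f e : (mpoly.msize f <= e.+1)%N ->
  exists2 A : R, 0 <= A & forall x, `|peval f x| <= A * (1 + `|x|) ^+ e.
Proof.
move=> /restr_poly_coef_bound[A A0 AP]; exists A => // x.
have -> : peval f x = (restr_poly f x 0)`_0.
  by rewrite -horner_coef0 horner_restr_poly scaler0 addr0.
by apply: AP; rewrite -(scale0r (0 : 'rV[R]_n)) enormZ normr0 mul0r.
Qed.

End lines.

(** * Convexity of exp(Q) P - S for univariate polynomials *)

Section convexity_on_interval.
Variable R : realType.
Local Open Scope convex_scope.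
Implicit Types P Q S : {poly R}.

(** The family exp(Q) P - S is stable under differentiation, which gives the
    second derivative by applying the rule for the first one twice. *)
Definition exp_gap Q P S (t : R) : R := expR Q.[t] * P.[t] - S.[t].

Lemma is_derive_exp_gap Q P S (t : R) :
  is_derive t (1 : R) (exp_gap Q P S)
    (exp_gap Q (Q^`() * P + P^`()) S^`() t).
Proof.
have dE : is_derive t (1 : R) (expR \o horner Q) (expR Q.[t] * Q^`().[t]).
  by apply: is_derive1_comp.
have dEP : is_derive t (1 : R) ((expR \o horner Q) * horner P)
    (expR Q.[t] * P^`().[t] + P.[t] * (expR Q.[t] * Q^`().[t])).
  exact: is_deriveM.
have dG : is_derive t (1 : R) ((expR \o horner Q) * horner P - horner S)
    (expR Q.[t] * P^`().[t] + P.[t] * (expR Q.[t] * Q^`().[t]) - S^`().[t]).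
  exact: is_deriveB.
apply: (trigger_derive dG).
by rewrite /exp_gap hornerD hornerM; ring.
Qed.

(** [second_derivative_convex] with the two derivatives given as functions, so
    that they can be computed in closed form beforehand. *)
Lemma second_derivative_convexW (f f1 f2 : R -> R^o) (a b : R^o) (t : {i01 R}) :
  (forall s : R, is_derive s (1 : R) f (f1 s)) ->
  (forall s : R, is_derive s (1 : R) f1 (f2 s)) ->
  a <= b -> (forall s : R, a < s < b -> 0 <= f2 s) ->
  f (a <| t |> b) <= f a <| t |> f b.
Proof.
move=> df df1 ab f2_ge0.
have Df : 'D_1 f = f1 by apply/funext => s; have [] := df s.
have cf : continuous f.
  move=> s; apply/differentiable_continuous/derivable1_diffP.
  by have [] := df s.
apply: second_derivative_convex => //.
- by move=> s /f2_ge0; rewrite Df; have [_ <-] := df1 s.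
- exact/cvg_at_left_filter/cf.
- exact/cvg_at_right_filter/cf.
- by move=> s _; rewrite Df; have [] := df1 s.
Qed.

Lemma exp_gap_convex Q P S (a b : R^o) (t : {i01 R}) : a <= b ->
  (forall s, a < s < b -> S^`()^`().[s] <= expR Q.[s] *
     ((Q^`()^`().[s] + Q^`().[s] ^+ 2) * P.[s] + 2 * Q^`().[s] * P^`().[s]
      + P^`()^`().[s])) ->
  exp_gap Q P S (a <| t |> b) <=
  (exp_gap Q P S a : R^o) <| t |> (exp_gap Q P S b : R^o).
Proof.
move=> ab H.
apply: (second_derivative_convexW _ (is_derive_exp_gap Q P S)
  (is_derive_exp_gap Q (Q^`() * P + P^`()) S^`())) => // s /H sH.
rewrite subr_ge0; apply: le_trans sH _; rewrite le_eqVlt; apply/orP; left.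
apply/eqP; congr (_ * _).
by rewrite !(derivD, derivM, hornerD, hornerM); ring.
Qed.

(** In the application [q1] is the derivative of the exponent, about which
    nothing is known: it is absorbed by completing the square
    [(`|q1| - C) ^+ 2 * p], at the price of [C ^+ 2 * p]. *)
Lemma second_order_bound (N m C E p p1 p2 q1 : R) :
  0 < m -> 0 <= C -> 1 <= E -> m <= p -> `|p1| <= C * p -> `|p2| <= C * p ->
  C ^+ 2 + C + 1 <= 2 * N ->
  m <= E * ((2 * N + q1 ^+ 2) * p + 2 * q1 * p1 + p2).
Proof.
move=> m0 C0 E1 mp p1C p2C NC.
have p0 : 0 < p by exact: lt_le_trans mp.
have q1p1 : - (`|q1| * (C * p)) <= q1 * p1.
  rewrite lerNl (le_trans (ler_norm _))// normrN normrM ler_wpM2l//.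
have p2' : - (C * p) <= p2 by move: p2C; rewrite ler_norml => /andP[].
have key : p <= (2 * N + q1 ^+ 2) * p + 2 * q1 * p1 + p2.
  have : 0 <= (2 * N - (C ^+ 2 + C + 1)) * p + (`|q1| - C) ^+ 2 * p.
    by rewrite addr_ge0// mulr_ge0 ?subr_ge0 ?sqr_ge0// ltW.
  have -> : q1 ^+ 2 = `|q1| ^+ 2 by rewrite real_normK ?num_real.
  by move: q1p1 p2'; lra.
apply: le_trans mp _; apply: (le_trans key); rewrite ler_peMl//.
by apply: ltW; exact: lt_le_trans key.
Qed.

End convexity_on_interval.

(** * Growth of a polynomial whose leading form is definite *)

Section growth.
Variables (R : realType) (n : nat).
Implicit Types (f : mpoly.mpoly n R) (x u : 'rV[R]_n) (t : R).

Lemma continuous_peval f : continuous (peval f).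
Proof.
pose monom (m : mpoly.multinom n) x := \prod_(i < n) x ord0 i ^+ m i.
have cmonom m : continuous (monom m).
  apply: (@continuous_big R _ *%R 1 xpredT _ 'rV[R]_n _
    (fun i x => x ord0 i ^+ m i)) => [|i _]; first exact: mul_continuous.
  move=> x; apply: (@continuous_comp _ _ _ _ (fun z : R => z ^+ m i)).
    exact: coord_continuous.
  exact: exprn_continuous.
have -> : peval f = (fun x => \sum_(m <- mpoly.msupp f) mpoly.mcoeff m f *
    monom m x).
  by apply/funext => x; rewrite /peval mpoly.mevalE.
apply: (@continuous_big R _ +%R 0 xpredT _ 'rV[R]_n _
  (fun m x => mpoly.mcoeff m f * monom m x)) => [|m _].
  exact: add_continuous.
move=> x; apply: (@continuousM _ _ (fun=> mpoly.mcoeff m f)).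
  exact: cst_continuous.
exact: cmonom.
Qed.

Lemma peval_homZ d f x t :
  peval (hom_component d f) (t *: x) = t ^+ d * peval (hom_component d f) x.
Proof.
rewrite /peval !mpoly.mevalE mulr_sumr big_seq [RHS]big_seq.
apply: eq_bigr => m mf; rewrite mulrCA; congr (_ * _).
have /mpoly.dhomogP/(_ m mf) dm := mpoly.pihomogP mpoly.mdeg d f.
have -> : d = (\sum_i m i)%N by rewrite -mpoly.mdegE -dm.
rewrite -prodrXr -big_split/=.
by apply: eq_bigr => i _; rewrite mxE exprMn.
Qed.

(** By homogeneity [c] can be taken as the minimum on the unit sphere, which is
    compact; that minimum is not 0, as 0 is the only zero of the form. *)
Lemma homogeneous_lower_bound d f : (0 < d)%N ->
  peval (hom_component d f) @^-1` [set 0] = [set 0] ->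
  exists2 c : R, 0 < c &
    forall x, c * `|x| ^+ d <= `|peval (hom_component d f) x|.
Proof.
move=> d0 f0; set h := peval _ in f0 *.
have hZ x t : h (t *: x) = t ^+ d * h x by exact: peval_homZ.
have sub x : x != 0 -> `| (`|x|)^-1 *: x | = 1.
  by move=> x0; rewrite normrZ normfV normr_id mulVf// normr_eq0.
(* In dimension 0 the sphere is empty, and any constant will do. *)
have [[x0 x01]|S0] := pselect ([set x : 'rV[R]_n | `|x| = 1] !=set0); last first.
  exists 1 => // x; have [->|xN0] := eqVneq x 0.
    by rewrite normr0 expr0n gtn_eqF// mulr0.
  by exfalso; apply: S0; exists (`|x|^-1 *: x); exact: sub.
have cS : compact [set x : 'rV[R]_n | `|x| = 1].
  apply: bounded_closed_compact.
    exists 1; split; first exact: real1.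
    by move=> r r1 x /= ->; exact: ltW.
  rewrite -[X in closed X]/((fun x : 'rV[R]_n => `|x|) @^-1` [set 1]).
  by apply: closed_comp => [x _|]; [exact: norm_continuous|exact: closed_eq].
have ch : continuous (fun x => `|h x|).
  move=> x; apply: (@continuous_comp _ _ _ h); first exact: continuous_peval.
  exact: norm_continuous.
have [z zS zmin] := compact_EVT_min (ex_intro _ x0 x01) cS
    (continuous_subspaceT ch).
exists `|h z|.
  rewrite normr_gt0; apply/eqP => hz.
  have : (h @^-1` [set 0]) z by [].
  rewrite f0 => /= z0; move: zS; rewrite inE/= z0 normr0 => /eqP.
  by rewrite eq_sym oner_eq0.
move=> x; have [->|xN0] := eqVneq x 0.
  by rewrite normr0 expr0n gtn_eqF// mulr0.
rewrite -[in leRHS](scale1r x) -(@mulfV _ `|x|) ?normr_eq0// -scalerA hZ.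
by rewrite normrM normrX normr_id mulrC ler_wpM2l// ?exprn_ge0// zmin// inE/= sub.
Qed.

Lemma msize_sub_lead f d : has_degree f d ->
  (mpoly.msize (f - hom_component d f)%R <= d)%N.
Proof.
rewrite /has_degree => sf.
rewrite {1}[f]mpoly.mpolyE (bigID (fun m => mpoly.mdeg m == d))/=.
rewrite addrAC -/(mpoly.pihomog _ _ _) subrr add0r.
apply: leq_trans (mpoly.msize_sum _ _ _) _.
apply/bigmax_leqP_seq => m mf md; apply: leq_trans (mpoly.msizeZ_le _ _) _.
rewrite mpoly.msizeX ltn_neqAle md/=.
by have := mpoly.msize_mdeg_lt mf; rewrite sf ltnS.
Qed.

(** With [c] the constant of the leading form and [A] that of the lower-degree
    part, the threshold [B0] is such that beyond it [1 + `|x|] is at most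
    [2 * `|x|] and the lower-degree part is at most half of
    [c * ((1 + `|x|) / 2) ^+ d]; below it, [m <= peval f x] is enough. *)
Lemma growth_bound (X : set 'rV[R]_n) f d m : (0 < d)%N -> has_degree f d ->
  peval (hom_component d f) @^-1` [set 0] = [set 0] ->
  0 < m -> (forall x, X x -> m <= peval f x) ->
  exists2 K : R, 0 <= K & forall x, X x -> (1 + `|x|) ^+ d <= K * peval f x.
Proof.
move=> d0 sf f0 m0 fm.
have [c c0 cP] := homogeneous_lower_bound d0 f0.
have := msize_sub_lead sf; case: d d0 sf f0 cP => // e _ sf f0 cP sg.
have [A A0 AP] := peval_bound sg.
set D : R := 2 ^+ e.+2 / c.
have D0 : 0 < D by rewrite divr_gt0// exprn_gt0.
set B0 := 2 + D * A.
have B00 : 0 <= B0 by rewrite addr_ge0// mulr_ge0// ltW.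
exists (D + B0 ^+ e.+1 / m).
  by rewrite addr_ge0 ?divr_ge0 ?exprn_ge0// ltW.
move=> x Xx; have mf := fm _ Xx; have f_gt0 : 0 < peval f x by exact: lt_le_trans mf.
set B := 1 + `|x|.
have B_ge0 : 0 <= B by rewrite addr_ge0.
rewrite mulrDl; have [BB0|B0B] := leP B B0.
  apply: (@le_trans _ _ (B0 ^+ e.+1 / m * peval f x)); last first.
    by rewrite lerDr mulr_ge0// ltW.
  apply: (@le_trans _ _ (B0 ^+ e.+1)); first by rewrite lerXn2r.
  rewrite -mulrA ler_peMr ?exprn_ge0//.
  by rewrite mulrC ler_pdivlMr// mul1r.
apply: (@le_trans _ _ (D * peval f x)); last first.
  by rewrite lerDl mulr_ge0 ?divr_ge0 ?exprn_ge0// ltW.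
rewrite /D mulrAC ler_pdivlMr// mulrC.
have DA : D * A <= B by apply: le_trans (ltW B0B); rewrite lerDr.
have AB : 2 ^+ e.+2 * (A * B ^+ e) <= c * B ^+ e.+1.
  rewrite mulrA [B ^+ e.+1]exprS [leRHS]mulrA ler_wpM2r ?exprn_ge0//.
  by move: DA; rewrite /D mulrAC ler_pdivrMr// [B * c]mulrC.
have rB : c * B ^+ e.+1 <= 2 ^+ e.+1 * (c * `|x| ^+ e.+1).
  rewrite mulrCA -exprMn ler_wpM2l ?(ltW c0)// lerXn2r ?nnegrE ?mulr_ge0//.
  have : 2 <= B by apply: le_trans (ltW B0B); rewrite lerDl mulr_ge0// ltW.
  by rewrite /B; lra.
have fE : peval f x = peval (hom_component e.+1 f) x
    + peval (f - hom_component e.+1 f) x.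
  by rewrite /peval mpoly.mevalB addrC subrK.
have low : c * `|x| ^+ e.+1 - A * B ^+ e <= peval f x.
  rewrite -[leRHS]ger0_norm ?(ltW f_gt0)// fE.
  rewrite lerBlDr; apply: le_trans (cP x) _.
  rewrite -lerBlDr; apply: le_trans (lerB_normD _ _).
  by rewrite lerD2l lerN2 AP.
have : 2 ^+ e.+2 * (c * `|x| ^+ e.+1 - A * B ^+ e) <= 2 ^+ e.+2 * peval f x.
  by rewrite ler_wpM2l ?exprn_ge0.
apply: le_trans; rewrite mulrBr lerBrDr.
apply: (le_trans (lerD (lexx _) AB)).
rewrite [2 ^+ e.+2]exprS -mulrA; move: rB; lra.
Qed.

End growth.

(** * Strong convexity *)

(** Segments are parametrized by arc length: with [enorm u = 1], the second
    derivatives of the exponent and of [m / 2 * enorm x ^+ 2] are the constants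
    [2 * N] and [m]. *)
Lemma strongly_convex_exp_sqdist (R : realType) (n : nat) (X : set 'rV[R]_n)
    (f : mpoly.mpoly n R) (m C N : R) (xi : 'rV[R]_n) :
  convex_set X -> 0 < m -> 0 <= C -> (forall x, X x -> m <= peval f x) ->
  (forall x u, X x -> enorm u = 1 ->
    `|(restr_poly f x u)`_1| <= C * peval f x /\
    `|(restr_poly f x u)`_2 *+ 2| <= C * peval f x) ->
  0 <= N -> C ^+ 2 + C + 1 <= 2 * N ->
  strongly_convex X (fun x => expR (N * enorm (x - xi) ^+ 2) * peval f x).
Proof.
move=> cX m0 C0 fm fC N0 NC; exists m => // t x y xX yX.
have [<-|yx] := eqVneq x y; first by rewrite !convmm.
pose L := enorm (y - x); pose u := L^-1 *: (y - x).
have L0 : 0 < L.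
  rewrite lt_neqAle enorm_ge0 andbT eq_sym; apply: contraNneq yx => /enorm_eq0.
  by move/eqP; rewrite subr_eq0 eq_sym.
have u1 : enorm u = 1 by rewrite enormZ ger0_norm ?invr_ge0 ?ltW// mulVf// gt_eqF.
have Lu : L *: u = y - x by rewrite scalerA mulfV ?scale1r// gt_eqF.
pose Q := N *: sqdist_poly (x - xi) u; pose P := restr_poly f x u.
pose S := (m / 2) *: sqdist_poly x u.
have gE s : exp_gap Q P S s = expR (N * enorm (x + s *: u - xi) ^+ 2) *
    peval f (x + s *: u) - m / 2 * enorm (x + s *: u) ^+ 2.
  by rewrite /exp_gap !hornerZ !horner_sqdist_poly horner_restr_poly addrAC.
have segE (r : {i01 R}) :
    (conv r x y : 'rV[R]_n) = x + ((1 - r%:num) * L) *: u.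
  rewrite -scalerA Lu scalerBr addrA addrAC.
  rewrite -[LHS]/(r%:num *: x + (1 - r%:num) *: y); congr (_ + _).
  by rewrite scalerBl scale1r opprB addrC subrK.
have xLu : x + L *: u = y by rewrite Lu addrC subrK.
have onX s : 0 < s < L -> X (x + s *: u).
  move=> /andP[s0 sL].
  have sL01 : 0 <= 1 - s / L <= 1.
    by rewrite subr_ge0 ler_pdivrMr// mul1r (ltW sL)/= gerBl divr_ge0// ltW.
  have -> : x + s *: u = conv (Itv01 (andP sL01).1 (andP sL01).2) x y.
    by rewrite segE/= subKr divfK// gt_eqF.
  by apply/set_mem; apply: cX.
have bounds s : 0 < s < L -> [/\ m <= P.[s], `|P^`().[s]| <= C * P.[s] &
    `|P^`()^`().[s]| <= C * P.[s]].
  move=> /onX Xs; rewrite deriv_horner_shift deriv2_horner_shift.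
  rewrite horner_restr_poly restr_poly_shift.
  by have [? ?] := fC _ _ Xs u1; split=> //; exact: fm.
have Q2 s : Q^`()^`().[s] = 2 * N.
  by rewrite !derivZ hornerZ deriv2_sqdist_poly u1 hornerC expr1n mulr1 mulrC.
have S2 s : S^`()^`().[s] = m.
  rewrite !derivZ hornerZ deriv2_sqdist_poly u1 hornerC expr1n mulr1.
  by rewrite divfK.
have := @exp_gap_convex _ Q P S 0 L t (ltW L0).
rewrite convRE mulr0 add0r !gE -segE scale0r addr0 xLu.
apply => s /bounds [mP P1 P2].
rewrite S2 Q2; apply: (second_order_bound (C := C)) => //.
rewrite -expR0 ler_expR hornerZ horner_sqdist_poly.
by rewrite mulr_ge0 ?sqr_ge0.
Qed.

Theorem theorem3 (R : realType) (n : nat) (X : set 'rV[R]_n)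
    (convX : convex_set X) (closedX : closed X)
    (f : mpoly.mpoly n R) (d : nat) (d_gt0 : (0 < d)%N)
    (deg_f : has_degree f d)
    (f_gt0 : forall x : 'rV[R]_n, X x -> 0 < peval f x)
    (lead_f : peval (hom_component d f) @^-1` [set 0] = [set 0])
    (inf_f : exists2 m : R, 0 < m &
       (m%:E <= ereal_inf [set (peval f x)%:E | x in X])%E) :
  exists N0 : nat, forall N : nat, (N0 <= N)%N -> forall xi : 'rV[R]_n,
    strongly_convex X
      (fun x => expR (N%:R * enorm (x - xi) ^+ 2) * peval f x).
Proof.
have [m m0 minf] := inf_f.
have fm x : X x -> m <= peval f x.
  move=> Xx; rewrite -lee_fin; apply: le_trans minf _.
  by apply: ereal_inf_lbound; exists x.
have [K K0 KP] := growth_bound d_gt0 deg_f lead_f m0 fm.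
have sf : (mpoly.msize f <= d.+1)%N by rewrite deg_f.
have [A A0 AP] := restr_poly_coef_bound sf.
(* The second derivative is twice the coefficient of degree 2. *)
pose C := 2 * (A * K).
have C0 : 0 <= C by rewrite !mulr_ge0.
have coefC x u k : X x -> enorm u = 1 ->
    2 * `|(restr_poly f x u)`_k| <= C * peval f x.
  move=> Xx u1; rewrite /C -!mulrA ler_wpM2l//.
  apply: le_trans (AP x u k _) _; first by rewrite u1.
  by rewrite ler_wpM2l ?KP.
exists (Num.bound (C ^+ 2 + C + 1)) => N N0N xi.
apply: (@strongly_convex_exp_sqdist _ _ _ _ m C) => //.
  move=> x u Xx u1; split.
    by apply: le_trans (coefC x u 1%N Xx u1); rewrite ler_peMl// ler1n.
  by rewrite -mulr_natl normrM normr_nat coefC.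
have C21 : 0 <= C ^+ 2 + C + 1 by rewrite !addr_ge0 ?sqr_ge0.
apply: le_trans (ltW (archi_boundP C21)) _.
apply: (@le_trans _ _ N%:R); first by rewrite ler_nat.
by rewrite ler_peMl// ler1n.
Qed.
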